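(* Let $0<\sigma\le 1$ and let $F(a,b)=\operatorname{sgn}(\sigma)\,K^{\sigma/2}=(ab)^{\sigma/2}$ for $a,b>0$, where $K=ab$. Then there exists no maximum-principle function (MPF) for the normal velocity $F$.
   Context: Notation: $\mathbb{R}^2_+=(0,\infty)^2$; subscripts $a,b$ denote partial derivatives. Normal velocity: a symmetric function $F\in C^2(\mathbb{R}^2_+)$, homogeneous of some degree $\sigma\in\mathbb{R}\setminus\{0\}$, with $F_a,F_b>0$ for all $a,b>0$. It is contracting if $F>0$ everywhere on $\mathbb{R}^2_+$ and expanding if $F<0$ everywhere on $\mathbb{R}^2_+$. Maximum-principle function (MPF) for a normal velocity $F$: a symmetric function $w\in C^2(\mathbb{R}^2_+)$, homogeneous of some degree $\chi\in\mathbb{R}\setminus\{0\}$, such that, with $\alpha=-w_a/w_b$ and $\alpha_a=\partial\alpha/\partial a$ (defined for $a\ne b$): (1) $w>0$ whenever $a\neq b$, and $w=0$ whenever $a=b$. (2) $\chi>0$ if $F$ is contracting, $\chi<0$ if $F$ is expanding. (3) $w_a<0$ for all $0<a<b$, and $w_a>0$ for all $0<b<a$. (4) For all $a,b>0$ (for $E_w,G_w$: $a\neq b$) one has $C_w(a,b)\le0$, $E_w(a,b)\le0$, $G_w(a,b)\le 0$, where $$C_w=w_a\,a\big((F_aa^2+F_bb^2)+(F-F_aa-F_bb)a\big)+w_b\,b\big((F_aa^2+F_bb^2)+(F-F_aa-F_bb)b\big),$$ $$E_w=w_a(F_{aa}+2F_{ab}\alpha+F_{bb}\alpha^2)-F_a(w_{aa}+2w_{ab}\alpha+w_{bb}\alpha^2)+2\,\frac{w_bF_a-w_aF_b}{a-b}\,\alpha^2,$$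 $$G_w=\frac1{\alpha^2}\Big(w_b(F_{aa}+2F_{ab}\alpha+F_{bb}\alpha^2)-F_b(w_{aa}+2w_{ab}\alpha+w_{bb}\alpha^2)+2\,\frac{w_bF_a-w_aF_b}{a-b}\Big).$$ (5) There are constants $c>0$, $d\in\mathbb{R}$ such that, evaluating $\alpha$ and $\alpha_a$ at $(a,b)=(\rho,1)$ with $0<\rho<1$: if $F$ is contracting, then either $\alpha=c$ and $\alpha_a=0$ for all sufficiently small $\rho$, or, as $\rho\to0$, $\alpha=\frac c\rho+o(\rho^{-1})$ and $\alpha_a=-\frac c{\rho^2}+o(\rho^{-1})$; if $F$ is expanding, then, as $\rho\to0$, either $\alpha=\frac c\rho+o(\rho^{-1})$ and $\alpha_a=-\frac c{\rho^2}+o(\rho^{-1})$, or $\alpha=\frac{c+d\rho}{\rho^2}+o(\rho^{-1})$ and $\alpha_a=-\frac{2c+d\rho}{\rho^3}+o(\rho^{-1})$. *)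

(* Defs.v *)
From Stdlib Require Import Reals Lra.
From Coquelicot Require Import Coquelicot.
Open Scope R_scope.

(* Functions on (0,oo)^2 are represented by total functions R -> R -> R; only
   their values at a, b > 0 are ever constrained.  Since the quadrant is open,
   partial derivatives at its points do not depend on the values outside. *)

Definition d_a (f : R -> R -> R) : R -> R -> R := partial_derive 1 0 f.
Definition d_b (f : R -> R -> R) : R -> R -> R := partial_derive 0 1 f.
Definition d_aa (f : R -> R -> R) : R -> R -> R := partial_derive 2 0 f.
Definition d_ab (f : R -> R -> R) : R -> R -> R := partial_derive 1 1 f.
Definition d_bb (f : R -> R -> R) : R -> R -> R := partial_derive 0 2 f.

(* [ex_diff_n f 2 a b] says that all partial derivatives of f up to order 2
   exist and are jointly continuous at (a, b). *)
Definition C2_quadrant (f : R -> R -> R) : Prop :=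
  forall a b, 0 < a -> 0 < b -> ex_diff_n f 2 a b.

Definition symmetric_quadrant (f : R -> R -> R) : Prop :=
  forall a b, 0 < a -> 0 < b -> f a b = f b a.

Definition homogeneous (deg : R) (f : R -> R -> R) : Prop :=
  forall l a b, 0 < l -> 0 < a -> 0 < b ->
    f (l * a) (l * b) = Rpower l deg * f a b.

Record normal_velocity (F : R -> R -> R) : Prop := {
  nv_C2 : C2_quadrant F;
  nv_sym : symmetric_quadrant F;
  nv_hom : exists sigma, sigma <> 0 /\ homogeneous sigma F;
  nv_mono : forall a b, 0 < a -> 0 < b -> 0 < d_a F a b /\ 0 < d_b F a b
}.

Definition contracting (F : R -> R -> R) : Prop :=
  forall a b, 0 < a -> 0 < b -> 0 < F a b.

Definition expanding (F : R -> R -> R) : Prop :=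
  forall a b, 0 < a -> 0 < b -> F a b < 0.

Definition alpha (w : R -> R -> R) (a b : R) : R := - d_a w a b / d_b w a b.

Definition C_w (F w : R -> R -> R) (a b : R) : R :=
  let S := d_a F a b * a ^ 2 + d_b F a b * b ^ 2 in
  let T := F a b - d_a F a b * a - d_b F a b * b in
  d_a w a b * a * (S + T * a) + d_b w a b * b * (S + T * b).

(* f_aa + 2 f_ab alpha + f_bb alpha^2 *)
Definition hess_alpha (w f : R -> R -> R) (a b : R) : R :=
  d_aa f a b + 2 * d_ab f a b * alpha w a b + d_bb f a b * alpha w a b ^ 2.

Definition E_w (F w : R -> R -> R) (a b : R) : R :=
  d_a w a b * hess_alpha w F a b - d_a F a b * hess_alpha w w a b
  + 2 * ((d_b w a b * d_a F a b - d_a w a b * d_b F a b) / (a - b))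
    * alpha w a b ^ 2.

Definition G_w (F w : R -> R -> R) (a b : R) : R :=
  1 / alpha w a b ^ 2 *
  (d_b w a b * hess_alpha w F a b - d_b F a b * hess_alpha w w a b
   + 2 * ((d_b w a b * d_a F a b - d_a w a b * d_b F a b) / (a - b))).

(* g(rho) = o(rho^{-1}) as rho -> 0, rho > 0 *)
Definition little_o_inv (g : R -> R) : Prop :=
  is_domin (at_right 0) (fun rho : R => / rho) g.

Definition asym_const (w : R -> R -> R) (c : R) : Prop :=
  at_right 0 (fun rho => alpha w rho 1 = c /\ d_a (alpha w) rho 1 = 0).

Definition asym_order1 (w : R -> R -> R) (c : R) : Prop :=
  little_o_inv (fun rho => alpha w rho 1 - c / rho) /\
  little_o_inv (fun rho => d_a (alpha w) rho 1 - - (c / rho ^ 2)).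

Definition asym_order2 (w : R -> R -> R) (c d : R) : Prop :=
  little_o_inv (fun rho => alpha w rho 1 - (c + d * rho) / rho ^ 2) /\
  little_o_inv
    (fun rho => d_a (alpha w) rho 1 - - ((2 * c + d * rho) / rho ^ 3)).

(* maximum-principle function w for the normal velocity F *)
Record MPF (F w : R -> R -> R) : Prop := {
  mpf_C2 : C2_quadrant w;
  mpf_sym : symmetric_quadrant w;
  mpf_hom : exists chi, chi <> 0 /\ homogeneous chi w /\
    (contracting F -> 0 < chi) /\ (expanding F -> chi < 0);
  mpf_pos : forall a b, 0 < a -> 0 < b -> a <> b -> 0 < w a b;
  mpf_diag : forall a, 0 < a -> w a a = 0;
  mpf_decr : forall a b, 0 < a -> a < b -> d_a w a b < 0;
  mpf_incr : forall a b, 0 < b -> b < a -> 0 < d_a w a b;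
  mpf_C : forall a b, 0 < a -> 0 < b -> C_w F w a b <= 0;
  mpf_E : forall a b, 0 < a -> 0 < b -> a <> b -> E_w F w a b <= 0;
  mpf_G : forall a b, 0 < a -> 0 < b -> a <> b -> G_w F w a b <= 0;
  mpf_asym : exists c d, 0 < c /\
    (contracting F -> asym_const w c \/ asym_order1 w c) /\
    (expanding F -> asym_order1 w c \/ asym_order2 w c d)
}.

Definition gauss_power (sigma : R) (a b : R) : R :=
  let K := a * b in sign sigma * Rpower K (sigma / 2).

(* The remaining lemmas check that gauss_power is indeed a normal velocity,
   contracting for sigma > 0. *)

Definition monomial (c p q : R) (a b : R) : R := c * Rpower a p * Rpower b q.

Lemma quadrant_locally_2d (P : R -> R -> Prop) (a b : R) :
  0 < a -> 0 < b -> (forall u v, 0 < u -> 0 < v -> P u v) -> locally_2d P a b.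
Proof.
intros Ha Hb H.
assert (Hm : 0 < Rmin a b) by (apply Rmin_pos; assumption).
exists (mkposreal _ Hm); simpl; intros u v Hu Hv.
assert (H1 := Rmin_l a b); assert (H2 := Rmin_r a b).
apply Rabs_lt_between in Hu; apply Rabs_lt_between in Hv.
apply H; lra.
Qed.

Lemma is_derive_Rpower (p x : R) :
  0 < x -> is_derive (fun t => Rpower t p) x (p * Rpower x (p - 1)).
Proof.
intros Hx; apply is_derive_Reals; now apply derivable_pt_lim_power.
Qed.

Lemma is_derive_monomial_a (c p q a b : R) : 0 < a ->
  is_derive (fun t => monomial c p q t b) a (monomial (c * p) (p - 1) q a b).
Proof.
intros Ha; unfold monomial.
apply (is_derive_ext (fun t => (c * Rpower b q) * Rpower t p)).
  intros t; simpl; ring.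
replace (c * p * Rpower a (p - 1) * Rpower b q)
  with ((c * Rpower b q) * (p * Rpower a (p - 1))) by ring.
now apply is_derive_scal, is_derive_Rpower.
Qed.

Lemma is_derive_monomial_b (c p q a b : R) : 0 < b ->
  is_derive (fun t => monomial c p q a t) b (monomial (c * q) p (q - 1) a b).
Proof.
intros Hb; unfold monomial.
replace (c * q * Rpower a p * Rpower b (q - 1))
  with ((c * Rpower a p) * (q * Rpower b (q - 1))) by ring.
now apply is_derive_scal, is_derive_Rpower.
Qed.

Lemma continuity_2d_monomial (c p q a b : R) :
  0 < a -> 0 < b -> continuity_2d_pt (monomial c p q) a b.
Proof.
intros Ha Hb; unfold monomial.
assert (HR : forall r x, 0 < x -> continuity_pt (fun t => Rpower t r) x).
  intros r x Hx; apply continuity_pt_filterlim.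
  apply (ex_derive_continuous (V := R_NormedModule) (fun t => Rpower t r)).
  exact (ex_intro _ _ (is_derive_Rpower r x Hx)).
apply continuity_2d_pt_mult; [apply continuity_2d_pt_mult|].
- apply continuity_2d_pt_const.
- apply (continuity_1d_2d_pt_comp (fun t => Rpower t p) (fun u _ => u)); auto.
  apply continuity_2d_pt_id1.
- apply (continuity_1d_2d_pt_comp (fun t => Rpower t q) (fun _ v => v)); auto.
  apply continuity_2d_pt_id2.
Qed.

Lemma ex_diff_n_monomial (n : nat) : forall c p q a b : R,
  0 < a -> 0 < b -> ex_diff_n (monomial c p q) n a b.
Proof.
induction n as [|n IH]; intros c p q a b Ha Hb; simpl.
  split; auto; now apply continuity_2d_monomial.
split; [now apply continuity_2d_monomial|].
split; [eexists; now apply is_derive_monomial_a|].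
split; [eexists; now apply is_derive_monomial_b|].
split.
- apply (ex_diff_n_ext_loc (monomial (c * p) (p - 1) q)); auto.
  apply quadrant_locally_2d; auto; intros u v Hu Hv.
  symmetry; now apply is_derive_unique, is_derive_monomial_a.
- apply (ex_diff_n_ext_loc (monomial (c * q) p (q - 1))); auto.
  apply quadrant_locally_2d; auto; intros u v Hu Hv.
  symmetry; now apply is_derive_unique, is_derive_monomial_b.
Qed.

Lemma gauss_power_monomial (sigma a b : R) : 0 < a -> 0 < b ->
  gauss_power sigma a b = monomial (sign sigma) (sigma / 2) (sigma / 2) a b.
Proof.
intros Ha Hb; unfold gauss_power, monomial.
rewrite <- Rpower_mult_distr by assumption; ring.
Qed.

Lemma gauss_power_normal_velocity (sigma : R) :
  sigma <> 0 -> normal_velocity (gauss_power sigma).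
Proof.
intros Hs.
assert (Hss : 0 < sign sigma * (sigma / 2)).
  destruct (Rdichotomy _ _ Hs) as [H|H].
  - rewrite sign_eq_m1 by exact H; lra.
  - rewrite sign_eq_1 by exact H; lra.
assert (Hpos : forall p q a b,
  0 < monomial (sign sigma * (sigma / 2)) p q a b).
  intros p q a b; unfold monomial.
  apply Rmult_lt_0_compat; [apply Rmult_lt_0_compat; [exact Hss|]|];
    apply exp_pos.
assert (Hm := fun a b => gauss_power_monomial sigma a b).
split.
- intros a b Ha Hb.
  apply (ex_diff_n_ext_loc
           (monomial (sign sigma) (sigma / 2) (sigma / 2))).
    apply quadrant_locally_2d; auto; intros; symmetry; auto.
  now apply ex_diff_n_monomial.
- intros a b _ _; unfold gauss_power; now rewrite (Rmult_comm a b).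
- exists sigma; split; [exact Hs|].
  intros l a b Hl Ha Hb; rewrite !Hm by (try apply Rmult_lt_0_compat; auto).
  unfold monomial; rewrite <- !Rpower_mult_distr by assumption.
  replace (Rpower l sigma) with (Rpower l (sigma / 2) * Rpower l (sigma / 2)).
    ring.
  rewrite <- Rpower_plus; f_equal; lra.
- intros a b Ha Hb; split.
  + replace (d_a (gauss_power sigma) a b) with
      (monomial (sign sigma * (sigma / 2)) (sigma / 2 - 1) (sigma / 2) a b).
      apply Hpos.
    symmetry; apply is_derive_unique.
    apply (is_derive_ext_loc
             (fun t => monomial (sign sigma) (sigma / 2) (sigma / 2) t b)).
      apply (filter_imp (fun t => 0 < t)); [|now apply open_gt].
      intros t Ht; symmetry; now apply Hm.
    now apply is_derive_monomial_a.
  + replace (d_b (gauss_power sigma) a b) with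
      (monomial (sign sigma * (sigma / 2)) (sigma / 2) (sigma / 2 - 1) a b).
      apply Hpos.
    symmetry; apply is_derive_unique.
    apply (is_derive_ext_loc
             (fun t => monomial (sign sigma) (sigma / 2) (sigma / 2) a t)).
      apply (filter_imp (fun t => 0 < t)); [|now apply open_gt].
      intros t Ht; symmetry; now apply Hm.
    now apply is_derive_monomial_b.
Qed.

Lemma gauss_power_contracting (sigma : R) :
  0 < sigma -> contracting (gauss_power sigma).
Proof.
intros Hs a b _ _; unfold gauss_power; rewrite sign_eq_1 by exact Hs.
rewrite Rmult_1_l; apply exp_pos.
Qed.

(* Main.v *)
Require Import Defs.
From Stdlib Require Import Reals Lra.
From Coquelicot Require Import Coquelicot.

(** By Euler's identities [a w_a + b w_b = chi w] and
    [a F_a + b F_b = sigma F], the quantity [C_w] equals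
    [(F_a a^2 + F_b b^2) chi w + (1 - sigma) F (a^2 w_a + b^2 w_b)].
    For [0 < a < b] we have [w_a < 0], hence [w_b > 0], and
    [a^2 w_a + b^2 w_b > a (a w_a + b w_b) = a chi w > 0].  So [C_w > 0]
    when [chi > 0] and [sigma <= 1], against condition (4). *)

(** The chain rule along a ray needs joint differentiability at the point, which the continuity of
    the partial derivatives supplies. *)
Lemma is_derive_ray (f : R -> R -> R) (a b : R) :
  C2_quadrant f -> 0 < a -> 0 < b ->
  is_derive (fun l => f (l * a) (l * b)) 1 (a * d_a f a b + b * d_b f a b).
Proof.
intros Hf Ha Hb.
assert (Hdiff : differentiable_pt_lim f (1 * a) (1 * b)
                  (d_a f a b) (d_b f a b)).
{ rewrite !Rmult_1_l.
  destruct (Hf a b Ha Hb) as (_ & _ & Hdb & [Hca _] & _).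
  apply filterdiff_differentiable_pt_lim.
  (* This criterion takes [d_a f] near the point and continuous at it, but [d_b f] only at the point
     itself. *)
  apply (is_derive_filterdiff f a b (d_a f) (d_b f a b)).
  - apply (locally_2d_locally
             (fun u v => is_derive (fun z => f z v) u (d_a f u v))).
    apply quadrant_locally_2d; [assumption..|].
    intros u v Hu Hv; apply Derive_correct.
    exact (proj1 (proj2 (Hf u v Hu Hv))).
  - now apply Derive_correct.
  - apply (proj1 (continuity_2d_pt_filterlim (d_a f) a b)), Hca. }
apply is_derive_Reals.
rewrite (Rmult_comm a), (Rmult_comm b).
apply (derivable_pt_lim_comp_2d f (fun l => l * a) (fun l => l * b));
  [exact Hdiff|apply is_derive_Reals; auto_derive; [exact I|ring]..].
Qed.

(** Both sides are the derivative at [l = 1] of [f (l * a) (l * b)], which equals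
    [Rpower l deg * f a b] for [l > 0]. *)
Lemma euler_homogeneous (f : R -> R -> R) (deg a b : R) :
  C2_quadrant f -> homogeneous deg f -> 0 < a -> 0 < b ->
  a * d_a f a b + b * d_b f a b = deg * f a b.
Proof.
intros Hf Hhom Ha Hb.
rewrite <- (is_derive_unique _ _ _ (is_derive_ray f a b Hf Ha Hb)).
apply is_derive_unique.
apply (is_derive_ext_loc (fun l => f a b * Rpower l deg)).
- apply (filter_imp (fun l => 0 < l)); [|apply open_gt, Rlt_0_1].
  intros l Hl; rewrite Hhom by assumption; apply Rmult_comm.
- replace (deg * f a b) with (f a b * (deg * Rpower 1 (deg - 1))).
  + apply is_derive_scal, is_derive_Rpower, Rlt_0_1.
  + unfold Rpower; rewrite ln_1, Rmult_0_r, exp_0; ring.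
Qed.

(** Condition (4) is contradicted at the single point [(1, 2)]. *)
Lemma contracting_degree_le_1_no_MPF (F w : R -> R -> R) (sigma : R) :
  normal_velocity F -> contracting F -> homogeneous sigma F -> sigma <= 1 ->
  ~ MPF F w.
Proof.
intros HF Hcontr Hhom Hsigma Hw.
destruct (mpf_hom _ _ Hw) as (chi & _ & Hwhom & Hchi & _).
specialize (Hchi Hcontr).
assert (H1 : 0 < 1) by lra; assert (H2 : 0 < 2) by lra.
assert (HeF := euler_homogeneous F sigma 1 2 (nv_C2 _ HF) Hhom H1 H2).
assert (Hew := euler_homogeneous w chi 1 2 (mpf_C2 _ _ Hw) Hwhom H1 H2).
destruct (nv_mono _ HF 1 2 H1 H2) as [HFa HFb].
assert (HF12 := Hcontr 1 2 H1 H2).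
assert (Hw12 : 0 < w 1 2) by (apply (mpf_pos _ _ Hw); lra).
assert (Hwa : d_a w 1 2 < 0) by (apply (mpf_decr _ _ Hw); lra).
assert (HC := mpf_C _ _ Hw 1 2 H1 H2).
unfold C_w in HC; cbv zeta in HC.
assert (Hcw : 0 < chi * w 1 2) by now apply Rmult_lt_0_compat.
assert (HS : 0 < (d_a F 1 2 * 1 ^ 2 + d_b F 1 2 * 2 ^ 2) * (chi * w 1 2)).
{ apply Rmult_lt_0_compat; lra. }
(* By [Hew] and [Hcw], [w_a + 2 w_b > 0]; as [w_a < 0], also [w_b > 0], hence [w_a + 4 w_b > 0]. *)
assert (HT : 0 <= (1 - sigma) * F 1 2 * (d_a w 1 2 + 4 * d_b w 1 2)).
{ apply Rmult_le_pos; [apply Rmult_le_pos|]; lra. }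
replace (F 1 2 - d_a F 1 2 * 1 - d_b F 1 2 * 2)
  with ((1 - sigma) * F 1 2) in HC by lra.
(* With [S = F_a + 4 F_b] and [T = (1 - sigma) F], [C_w] at [(1, 2)] is
   [S (w_a + 2 w_b) + T (w_a + 4 w_b)], the sum of the quantities in [HS] and [HT]. *)
rewrite <- Hew in HS; lra.
Qed.

(** The degree in [nv_hom] is existentially bound; the bound [sigma <= 1] calls for its explicit
    value. *)
Lemma gauss_power_homogeneous (sigma : R) :
  homogeneous sigma (gauss_power sigma).
Proof.
intros l a b Hl Ha Hb; unfold gauss_power.
replace (l * a * (l * b)) with (l * l * (a * b)) by ring.
rewrite <- !(Rpower_mult_distr _ _ (sigma / 2))
  by (repeat apply Rmult_lt_0_compat; assumption).
rewrite <- Rpower_plus.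
replace (sigma / 2 + sigma / 2) with sigma by field; ring.
Qed.

Theorem theorem7p2 :
  forall sigma : R, 0 < sigma <= 1 ->
    ~ exists w : R -> R -> R, MPF (gauss_power sigma) w.
Proof.
intros sigma [Hpos Hle] [w Hw].
apply (contracting_degree_le_1_no_MPF (gauss_power sigma) w sigma); auto.
- apply gauss_power_normal_velocity; lra.
- now apply gauss_power_contracting.
- apply gauss_power_homogeneous.
Qed.
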